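(* Let $\mathcal{F}$ be a homomorphism distinguishing closed class of simple graphs. Then $\mathcal{F}$ is minor-closed if and only if $\equiv_{\mathcal{F}}$ is preserved under taking complements, i.e.\ for all simple graphs $G$ and $H$ it holds that $G\equiv_{\mathcal{F}} H$ if and only if $\overline{G}\equiv_{\mathcal{F}}\overline{H}$.
   Context: All graphs are finite, undirected, without multiple edges; simple means without loops. $\hom(F,G)$ denotes the number of homomorphisms from $F$ to $G$ (maps on vertices preserving adjacency and loops). For a class $\mathcal{F}$ of graphs, $G\equiv_{\mathcal{F}}H$ means $\hom(F,G)=\hom(F,H)$ for all $F\in\mathcal{F}$. The homomorphism distinguishing closure $\mathrm{cl}(\mathcal{F})$ is the class of all simple graphs $K$ such that for all simple graphs $G,H$, $G\equiv_{\mathcal{F}}H$ implies $\hom(K,G)=\hom(K,H)$; $\mathcal{F}$ is homomorphism distinguishing closed if $\mathrm{cl}(\mathcal{F})=\mathcal{F}$. $\overline{G}$ denotes the complement of a simple graph $G$ (same vertices, $E(\overline G)=\binom{V(G)}{2}\setminus E(G)$). A minor of a simple graph $F$ is a subgraph of a graph obtained from $F$ by contracting edges, where $F'$ is obtained from $F$ by contracting edges if there is a partition $\mathcal{P}$ of $V(F)$ with $F[P]$ connected for all $P\in\mathcal{P}$ and $F'\cong F/\mathcal{P}$ (the quotient with vertex set $\mathcal{P}$ and an edge $PQ$, $P\ne Q$, iff some $p\in P$, $q\in Q$ are adjacent in $F$). *)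

(* Defs.v *)
From mathcomp Require Import all_boot.
Set Implicit Arguments. Unset Strict Implicit. Unset Printing Implicit Defensive.

Record sgraph := SGraph {
  nv : nat;
  adj : rel 'I_nv;
  adj_sym : forall x y, adj x y = adj y x;
  adj_irr : forall x, adj x x = false }.

Definition hom (F G : sgraph) : nat :=
  #|[set f : {ffun 'I_(nv F) -> 'I_(nv G)} |
      [forall x, forall y, adj x y ==> adj (f x) (f y)]]|.

Definition gclass := sgraph -> Prop.

Definition hom_equiv (C : gclass) (G H : sgraph) : Prop :=
  forall F, C F -> hom F G = hom F H.

Definition hd_cl (C : gclass) : gclass :=
  fun K => forall G H : sgraph, hom_equiv C G H -> hom K G = hom K H.

Definition hd_closed (C : gclass) : Prop := forall K, hd_cl C K <-> C K.

Definition compl_adj (G : sgraph) : rel 'I_(nv G) :=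
  fun x y => (x != y) && ~~ adj x y.

Lemma compl_adj_sym (G : sgraph) x y : @compl_adj G x y = @compl_adj G y x.
Proof. by rewrite /compl_adj eq_sym adj_sym. Qed.

Lemma compl_adj_irr (G : sgraph) x : @compl_adj G x x = false.
Proof. by rewrite /compl_adj eqxx. Qed.

Definition compl (G : sgraph) : sgraph :=
  @SGraph (nv G) (@compl_adj G) (@compl_adj_sym G) (@compl_adj_irr G).

(* F' is (isomorphic to) a graph obtained from F by contracting edges:
   p maps V(F) onto V(F'), its fibres form the partition, each fibre
   induces a connected subgraph of F, and F' is the quotient F/P. *)
Definition contraction (F F' : sgraph) : Prop :=
  exists p : 'I_(nv F) -> 'I_(nv F'),
    (forall a, exists u, p u = a) /\
    (forall u v, p u = p v ->
       connect (fun x y => [&& adj x y, p x == p u & p y == p u]) u v) /\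
    (forall a b, adj a b =
       (a != b) && [exists u, exists v, [&& p u == a, p v == b & adj u v]]).

Definition subgraph (M G : sgraph) : Prop :=
  exists i : 'I_(nv M) -> 'I_(nv G),
    injective i /\ (forall x y, adj x y -> adj (i x) (i y)).

Definition minor (M F : sgraph) : Prop :=
  exists F' : sgraph, contraction F F' /\ subgraph M F'.

Definition minor_closed (C : gclass) : Prop :=
  forall F M, C F -> minor M F -> C M.

(* Main.v *)
Require Import Defs.
From mathcomp Require Import all_boot zify.
Set Implicit Arguments. Unset Strict Implicit. Unset Printing Implicit Defensive.

(** Write G° for G with a loop at every vertex. A homomorphism K -> G° is a homomorphism
    to G from the contraction of K along the edges it collapses, and by Moebius inversion
    the numbers hom(K, G°), for K a spanning subgraph of F, determine the number of maps
    that send no edge of F to an edge of G°, which is the number of homomorphisms from F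
    to the complement of G. Hence minor-closed classes are preserved under complements.

    Conversely, G ≡ H implies G × w ≡ H × w for every symmetric relation w, loops allowed,
    hence equality of hom(F, -) on the complements of these products, and by Moebius
    inversion this remains true when only the maps whose w-component is onto are counted.
    If w is a spanning subgraph of F, then an induction on its number of edges isolates
    the graph w itself, which therefore lies in the closure. With all spanning subgraphs
    of F available, hom(F, (G × w)°) is an invariant too, and if w is a contraction of F,
    then an induction on its vertices (downwards) and edges (upwards) isolates w again.
    All sums involved have nonnegative terms, so no linear independence argument is
    needed. Isolated vertices are deleted by dividing by the number of vertices of G. *)

(** * Moebius inversion and cancellation in sums *)

Lemma card_fibers (T X : finType) (A : {set T}) (phi : T -> X) :
  #|A| = \sum_L #|[set f in A | phi f == L]|.
Proof.
rewrite -sum1_card (partition_big phi predT) //=.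
by apply: eq_bigr => L _; rewrite -sum1_card; apply: eq_bigl => f; rewrite inE.
Qed.

Section Moebius.
Variables (X T1 T2 : finType) (A1 : {set T1}) (A2 : {set T2}).
Variables (phi1 : T1 -> {set X}) (phi2 : T2 -> {set X}).

Lemma card_fiber_sup (T : finType) (A : {set T}) (phi : T -> {set X}) (S : {set X}) :
  #|[set f in A | S \subset phi f]| =
  #|[set f in A | phi f == S]|
    + \sum_(L : {set X} | S \proper L) #|[set f in A | phi f == L]|.
Proof.
rewrite (card_fibers _ phi) (bigID (fun L : {set X} => S \subset L)) /=.
rewrite [Y in _ + Y = _]big1 => [|L nSL]; last first.
  apply/eqP; rewrite cards_eq0; apply/eqP/setP=> f; rewrite !inE.
  by apply/negbTE/negP => /andP[/andP[_ SL] /eqP fL]; rewrite -fL SL in nSL.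
rewrite addn0 (bigD1 S) //=; congr (_ + _).
  apply: eq_card => f; rewrite !inE -andbA; congr (_ && _).
  by case: eqP => [->|_]; rewrite ?subxx ?andbF.
apply: eq_big => [L|L /andP[SL _]]; first by rewrite properEneq eq_sym andbC.
apply: eq_card => f; rewrite !inE -andbA; congr (_ && _).
by case: eqP => [->|_]; rewrite ?SL ?andbF.
Qed.

(** Downward induction on [S]: the count of supersets is the fibre over [S] plus the fibres over
    strictly larger sets, which agree by induction and cancel. *)
Lemma card_fiber_moebius :
  (forall S : {set X}, #|[set f in A1 | S \subset phi1 f]| =
             #|[set f in A2 | S \subset phi2 f]|) ->
  forall S : {set X}, #|[set f in A1 | phi1 f == S]| = #|[set f in A2 | phi2 f == S]|.
Proof.
move=> eqS S; have [n] := ubnP #|~: S|.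
elim: n S => // n IHn S ltn; have := eqS S.
rewrite !card_fiber_sup [Y in _ + Y = _](eq_bigr
  (fun L => #|[set f in A2 | phi2 f == L]|)); first by move/addIn.
move=> L SL; rewrite IHn // -ltnS; apply: leq_trans ltn.
by rewrite ltnS proper_card // properC.
Qed.

End Moebius.

(** If [x < y], every left term is at most its right counterpart, strictly at [t0], so the sums
    differ; the other case is symmetric. This isolates one unknown count when all other terms are
    known to agree or are copies of it. *)
Lemma sum_eq_cancel (I : finType) (P : pred I) (a b : I -> nat) x y t0 :
  \sum_(t | P t) a t = \sum_(t | P t) b t ->
  (forall t, P t -> a t = b t \/ (a t = x /\ b t = y)) ->
  P t0 -> a t0 = x -> b t0 = y -> x = y.
Proof.
move=> eqs dich Pt0 ax bY.
have main (a' b' : I -> nat) x' y' :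
    \sum_(t | P t) a' t = \sum_(t | P t) b' t ->
    (forall t, P t -> a' t = b' t \/ (a' t = x' /\ b' t = y')) ->
    a' t0 = x' -> b' t0 = y' -> x' < y' -> False.
  move=> e d a0 b0 lt; move: e; rewrite (bigD1 t0) // [RHS](bigD1 t0) //= a0 b0.
  have : \sum_(t | P t && (t != t0)) a' t <= \sum_(t | P t && (t != t0)) b' t.
    apply: leq_sum => t /andP[Pt _].
    by case: (d t Pt) => [->//|[-> ->]]; apply: ltnW.
  by move: lt; lia.
case: (ltngtP x y) => // lt.
  by case: (main a b x y).
case: (main b a y x) => // t Pt.
by case: (dich t Pt) => [->|[-> ->]]; [left|right].
Qed.

(** * Homomorphisms between relations on finite types *)

Section Homs.
Variables (A T : finType).
Implicit Types (s : rel A) (r : rel T).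

Definition homs s r : {set {ffun A -> T}} :=
  [set f : {ffun A -> T} | [forall x, forall y, s x y ==> r (f x) (f y)]].

Lemma homsP s r (f : {ffun A -> T}) :
  reflect (forall x y, s x y -> r (f x) (f y)) (f \in homs s r).
Proof.
rewrite inE; apply: (iffP forallP) => [h x y|h x].
  by move/forallP: (h x) => /(_ y) /implyP.
by apply/forallP => y; apply/implyP/h.
Qed.

Lemma eq_homs s s' r r' : s =2 s' -> r =2 r' -> homs s r = homs s' r'.
Proof.
by move=> es er; apply/setP=> f; apply/homsP/homsP => h x y;
  [rewrite -es -er|rewrite es er]; apply: h.
Qed.

End Homs.

Lemma card_homs_iso (A A' T T' : finType) (s : rel A) (s' : rel A')
    (r : rel T) (r' : rel T') (phi : A -> A') (psi : T -> T') :
  bijective phi -> bijective psi ->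
  (forall x y, s' (phi x) (phi y) = s x y) ->
  (forall x y, r' (psi x) (psi y) = r x y) ->
  #|homs s r| = #|homs s' r'|.
Proof.
move=> [phi' phiK phi'K] [psi' psiK psi'K] es er.
pose h (f : {ffun A -> T}) := [ffun a => psi (f (phi' a))].
have hinj : injective h.
  move=> f g /ffunP e; apply/ffunP => x; have := e (phi x).
  by rewrite !ffunE phiK => /(can_inj psiK).
rewrite -(card_imset _ hinj); apply: eq_card => g.
apply/imsetP/homsP => [[f /homsP hf ->] x y|hg].
  by rewrite -{1}(phi'K x) -{1}(phi'K y) es !ffunE er; apply: hf.
exists [ffun x => psi' (g (phi x))]; last first.
  by apply/ffunP => x; rewrite !ffunE psi'K phi'K.
by apply/homsP => x y sxy; rewrite -er !ffunE !psi'K; apply: hg; rewrite es.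
Qed.

(* By Moebius inversion over the set of pairs of s that f sends into r. *)
Lemma card_homs_negb (A T1 T2 : finType) (s : rel A) (r1 : rel T1) (r2 : rel T2) :
  symmetric s -> symmetric r1 -> symmetric r2 ->
  (forall s' : rel A, symmetric s' -> subrel s' s ->
     #|homs s' r1| = #|homs s' r2|) ->
  #|homs s (fun x y => ~~ r1 x y)| = #|homs s (fun x y => ~~ r2 x y)|.
Proof.
move=> ss sr1 sr2 eqs'.
pose E := [set p : A * A | s p.1 p.2].
pose phi (T : finType) (r : rel T) (f : {ffun A -> T}) :=
  [set p in E | r (f p.1) (f p.2)].
have negE (T : finType) (r : rel T) :
    homs s (fun x y => ~~ r x y) = [set f in setT | phi T r f == set0].
  apply/setP=> f; rewrite [RHS]inE in_setT andTb; apply/homsP/eqP => [h|/setP h x y sxy].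
    apply/setP=> -[x y]; rewrite !inE /=; apply/negbTE/negP => /andP[sxy].
    exact/negP/h.
  by have := h (x, y); rewrite !inE sxy /= => ->.
rewrite !negE; apply: card_fiber_moebius => S.
(* The value of [phi] always lies in [E], so other sets [S] have no maps above them. *)
have [SE|nSE] := boolP (S \subset E); last first.
  have emp (T : finType) (r : rel T) :
      [set f in setT | S \subset phi T r f] = set0.
    apply/setP=> f; rewrite !inE /=; apply/negbTE; apply: contra nSE => h.
    by apply: subset_trans h _; apply/subsetP => p; rewrite inE => /andP[].
  by rewrite !emp !cards0.
(* The symmetric closure of [S] imposes the same condition as [S], because [r] is symmetric. *)
pose s' x y := ((x, y) \in S) || ((y, x) \in S).
have ss' : symmetric s' by move=> x y; rewrite /s' orbC.
have supE (T : finType) (r : rel T) : symmetric r ->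
    [set f in setT | S \subset phi T r f] = homs s' r.
  move=> sr; apply/setP=> f; rewrite [LHS]inE in_setT andTb.
  apply/subsetP/homsP => [h x y|h [x y] Sxy].
    by case/orP => /h; rewrite !inE /= => /andP[_]; rewrite // sr.
  rewrite inE (subsetP SE) //=; apply: h.
  by rewrite /s' Sxy.
rewrite !supE //; apply: eqs' => // x y.
by case/orP => /(subsetP SE); rewrite inE //= ss.
Qed.

(** * Graphs from relations, loops, and products *)

Section RelGraph.
Variables (T : finType) (r : rel T).
Hypotheses (r_sym : symmetric r) (r_irr : irreflexive r).

(** The vertices of an [sgraph] are ordinals, so a relation on any other finite type is transported
    along [enum_val]. *)
Definition rel_graph_adj : rel 'I_#|T| := fun x y => r (enum_val x) (enum_val y).

Lemma rel_graph_adj_sym x y : rel_graph_adj x y = rel_graph_adj y x.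
Proof. exact: r_sym. Qed.

Lemma rel_graph_adj_irr x : rel_graph_adj x x = false.
Proof. exact: r_irr. Qed.

Definition rel_graph : sgraph := SGraph rel_graph_adj_sym rel_graph_adj_irr.

End RelGraph.

(* [loop_rel true r] is r with a loop at every vertex, [loop_rel false r] its
   complement. *)
Definition loop_rel (b : bool) (T : finType) (r : rel T) : rel T :=
  fun x y => ((x == y) || r x y) == b.

Lemma loop_rel_sym b (T : finType) (r : rel T) :
  symmetric r -> symmetric (loop_rel b r).
Proof. by move=> rs x y; rewrite /loop_rel (eq_sym x) rs. Qed.

Lemma loop_rel_negb b (T : finType) (r : rel T) x y :
  loop_rel (~~ b) r x y = ~~ loop_rel b r x y.
Proof. by case: b; rewrite /loop_rel /= eqb_id eqbF_neg ?negbK. Qed.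

Lemma hom_compl F G : hom F (compl G) = #|homs (@adj F) (loop_rel false (@adj G))|.
Proof.
congr #|pred_of_set _|; apply: eq_homs => // x y.
by rewrite /= /compl_adj /loop_rel eqbF_neg negb_or.
Qed.

Lemma card_homs_loop_rel_graph b (A T : finType) (s : rel A) (r : rel T)
    (rs : symmetric r) (ri : irreflexive r) :
  #|homs s (loop_rel b (@adj (rel_graph rs ri)))| = #|homs s (loop_rel b r)|.
Proof.
apply: (@card_homs_iso _ _ _ _ _ _ _ _ id enum_val) => //.
- by exists id.
- exact: enum_val_bij.
- by move=> x y; rewrite /loop_rel (inj_eq enum_val_inj).
Qed.

Lemma hom_rel_graph F (T : finType) (r : rel T)
    (rs : symmetric r) (ri : irreflexive r) :
  hom F (rel_graph rs ri) = #|homs (@adj F) r|.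
Proof.
apply: (@card_homs_iso _ _ _ _ _ _ _ _ id enum_val) => //.
- by exists id.
- exact: enum_val_bij.
Qed.

(** The categorical product. Loops in [w] are harmless: irreflexivity of [r] alone makes the product
    irreflexive. *)
Definition prod_rel (T V : finType) (r : rel T) (w : rel V) : rel (T * V) :=
  fun p q => r p.1 q.1 && w p.2 q.2.

Lemma prod_rel_sym (T V : finType) (r : rel T) (w : rel V) :
  symmetric r -> symmetric w -> symmetric (prod_rel r w).
Proof. by move=> rs ws x y; rewrite /prod_rel rs ws. Qed.

Lemma prod_rel_irr (T V : finType) (r : rel T) (w : rel V) :
  irreflexive r -> irreflexive (prod_rel r w).
Proof. by move=> ri x; rewrite /prod_rel ri. Qed.

Section FfunPair.
Variables (A T V : finType).

Definition ffun_pair (u : {ffun A -> T} * {ffun A -> V}) : {ffun A -> T * V} :=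
  [ffun x => (u.1 x, u.2 x)].

Lemma ffun_pair_bij : bijective ffun_pair.
Proof.
exists (fun f : {ffun A -> T * V} => ([ffun x => (f x).1], [ffun x => (f x).2])).
  by case=> g t; congr (_, _); apply/ffunP => x; rewrite !ffunE.
by move=> f; apply/ffunP => x; rewrite !ffunE /=; case: (f x).
Qed.

Lemma card_ffun_pair (B : {set {ffun A -> T * V}}) :
  #|B| = \sum_(t : {ffun A -> V}) #|[set g | ffun_pair (g, t) \in B]|.
Proof.
rewrite -(on_card_preimset (onW_bij _ ffun_pair_bij)).
rewrite (card_fibers _ snd); apply: eq_bigr => t _.
have inj : injective (fun g : {ffun A -> T} => (g, t)) by move=> g g' [].
rewrite -[RHS](card_imset _ inj); apply: eq_card => -[g t'].
apply/idP/imsetP => [|[g' gB [-> ->]]]; last by move: gB; rewrite !inE eqxx andbT.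
by rewrite !inE => /andP[gB /eqP/= e]; exists g; rewrite ?inE -?e.
Qed.

End FfunPair.

Lemma card_homs_prod (A T V : finType) (s : rel A) (r : rel T) (w : rel V) :
  #|homs s (prod_rel r w)| = #|homs s r| * #|homs s w|.
Proof.
rewrite -cardsX -(on_card_preimset (onW_bij _ (@ffun_pair_bij A T V))).
apply: eq_card => -[g t]; rewrite [LHS]inE in_setX.
apply/homsP/andP => [h|[/homsP h1 /homsP h2] x y sxy]; last first.
  by rewrite /prod_rel !ffunE /= h1 ?h2.
by split; apply/homsP => x y /h; rewrite /prod_rel !ffunE => /andP[].
Qed.

(** * Contractions *)

(** The body of [contraction] with its witness exposed; the two are convertible up to the
    existential. *)
Definition contraction_map (F F' : sgraph) (p : 'I_(nv F) -> 'I_(nv F')) : Prop :=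
    (forall a, exists u, p u = a) /\
    (forall u v, p u = p v ->
       connect (fun x y => [&& adj x y, p x == p u & p y == p u]) u v) /\
    (forall a b, adj a b =
       (a != b) && [exists u, exists v, [&& p u == a, p v == b & adj u v]]).

(** The homomorphisms to [G] with loops added that collapse exactly the edges collapsed by [t]. *)
Definition collapse_homs (F : sgraph) (Y : eqType) (t : 'I_(nv F) -> Y)
    (G : sgraph) : {set {ffun 'I_(nv F) -> 'I_(nv G)}} :=
  [set f : {ffun 'I_(nv F) -> 'I_(nv G)} | [forall x, forall y, adj x y ==>
     if t x == t y then f x == f y else adj (f x) (f y)]].

Lemma collapse_homsP F (Y : eqType) (t : 'I_(nv F) -> Y) G
    (f : {ffun 'I_(nv F) -> 'I_(nv G)}) :
  reflect (forall x y, adj x y ->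
             if t x == t y then f x == f y else adj (f x) (f y))
          (f \in collapse_homs t G).
Proof.
rewrite inE; apply: (iffP forallP) => [h x y|h x].
  by move/forallP: (h x) => /(_ y) /implyP.
by apply/forallP => y; apply/implyP/h.
Qed.

Lemma eq_collapse_homs F (Y Y' : eqType) (t : 'I_(nv F) -> Y)
    (t' : 'I_(nv F) -> Y') G :
  (forall x y, adj x y -> (t x == t y) = (t' x == t' y)) ->
  collapse_homs t G = collapse_homs t' G.
Proof.
move=> e; apply/setP => f; apply/collapse_homsP/collapse_homsP => h x y xy;
  by have := h x y xy; rewrite e.
Qed.

(** Pulling back along [p] is injective since [p] is onto. Conversely, a map collapsing the edges
    inside fibres is constant on each fibre, by connectedness, and so descends. *)
Lemma hom_contraction (F F' : sgraph) (p : 'I_(nv F) -> 'I_(nv F')) G :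
  contraction_map p -> hom F' G = #|collapse_homs p G|.
Proof.
move=> [p_onto [p_conn p_adj]].
pose pull (g : {ffun 'I_(nv F') -> 'I_(nv G)}) := [ffun x => g (p x)].
have inj : injective pull.
  move=> g g' /ffunP e; apply/ffunP => a; have [u <-] := p_onto a.
  by have := e u; rewrite !ffunE.
rewrite -[LHS](card_imset _ inj); apply: eq_card => f.
apply/imsetP/collapse_homsP => [[g /homsP hg ->] x y xy|hf].
  rewrite !ffunE; case: eqP => [->//|/eqP npxy]; apply: hg.
  rewrite p_adj npxy; apply/existsP; exists x; apply/existsP; exists y.
  by rewrite !eqxx.
have f_fib x y : p x = p y -> f x = f y.
  move=> /p_conn /connectP[q qp ->].
  suff : forall z, path (fun x0 y0 => [&& adj x0 y0, p x0 == p x & p y0 == p x]) z q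
    -> f z = f (last z q) by apply.
  elim: q {qp} => //= y' q IHq z /andP[/and3P[zy /eqP pz /eqP py] /IHq <-].
  by have := hf _ _ zy; rewrite pz py eqxx => /eqP.
have onto a : exists u, p u == a by have [u <-] := p_onto a; exists u.
have repK a : p (xchoose (onto a)) = a by apply/eqP/(xchooseP (onto a)).
exists [ffun a => f (xchoose (onto a))]; last first.
  by apply/ffunP => x; rewrite !ffunE; apply: f_fib; rewrite repK.
apply/homsP => a b; rewrite p_adj => /andP[nab /existsP[u /existsP[v]]].
case/and3P=> /eqP pu /eqP pv uv; rewrite !ffunE.
rewrite (f_fib (xchoose (onto a)) u) ?repK ?pu // (f_fib (xchoose (onto b)) v) ?repK ?pv //.
by have := hf _ _ uv; rewrite pu pv (negbTE nab).
Qed.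

(** The fibres of [t] may be disconnected, so the parts are the components of the graph of edges on
    which [t] is constant. *)
Lemma contraction_along F (Y : eqType) (t : 'I_(nv F) -> Y) :
  exists F' (p : 'I_(nv F) -> 'I_(nv F')), contraction_map p /\
    forall x y, (p x == p y) =
      connect (fun u v => adj u v && (t u == t v)) x y.
Proof.
pose e u v := adj u v && (t u == t v).
have se : connect_sym e.
  by apply: sym_connect_sym => u v; rewrite /e adj_sym eq_sym.
pose V := {x | roots e x}.
pose q x : V := Sub (root e x) (roots_root se x).
have qE x y : (q x == q y) = connect e x y by rewrite -val_eqE /= root_connect.
pose r (a b : V) := (a != b) && [exists u, exists v, [&& q u == a, q v == b & adj u v]].
have rs : symmetric r.
  move=> a b; rewrite /r eq_sym; congr (_ && _).
  by apply/existsP/existsP => -[u /existsP[v /and3P[qu qv uv]]]; exists v;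
     apply/existsP; exists u; rewrite qu qv adj_sym.
have ri : irreflexive r by move=> a; rewrite /r eqxx.
exists (rel_graph rs ri), (fun x => enum_rank (q x)); split; last first.
  by move=> x y; rewrite (inj_eq enum_rank_inj).
split; [|split].
- move=> a; exists (val (enum_val a)); rewrite -[RHS]enum_valK; congr enum_rank.
  by apply: val_inj; apply/eqP; apply: (valP (enum_val a)).
- move=> u v /enum_rank_inj/eqP; rewrite qE => /connectP[w ew ->].
  set e' := (fun _ _ => _).
  suff : forall z, q z = q u -> path e z w -> connect e' z (last z w) by apply.
  elim: w {ew} => //= y w IHw z qz /andP[ezy yw].
  have qy : q y = q u by rewrite -qz; apply/eqP; rewrite qE se connect1.
  apply: connect_trans (connect1 _) (IHw y qy yw).
  by rewrite /e' qz qy !eqxx; case/andP: ezy => ->.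
- move=> a b; rewrite /= /rel_graph_adj /r (inj_eq enum_val_inj); congr (_ && _).
  apply: eq_existsb => u; apply: eq_existsb => v.
  by rewrite -!(inj_eq enum_val_inj) !enum_rankK.
Qed.

(** On edges [p] and [t] collapse alike, which is all that [collapse_homs] depends on. *)
Lemma contraction_along_edge F (Y : eqType) (t : 'I_(nv F) -> Y) :
  exists F' (p : 'I_(nv F) -> 'I_(nv F')), [/\ contraction_map p,
    forall x y, p x = p y -> t x = t y &
    forall x y, adj x y -> (p x == p y) = (t x == t y)].
Proof.
have [F' [p [cp pE]]] := contraction_along t; exists F', p.
have sub x y : p x = p y -> t x = t y.
  move=> /eqP; rewrite pE => /connectP[w ew ->].
  elim: w x ew => //= z w IHw x /andP[/andP[_ /eqP ->]]; exact: IHw.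
split=> // x y xy; apply/eqP/eqP => [/sub//|txy].
by apply/eqP; rewrite pE connect1 // xy txy eqxx.
Qed.

(** * From minor-closed classes to complements *)

Section LoopInvariance.
Variable C : gclass.
Hypothesis contr_closed : forall F F', C F -> contraction F F' -> C F'.

Lemma card_collapse_homs F (Y : eqType) (t : 'I_(nv F) -> Y) G H :
  C F -> hom_equiv C G H -> #|collapse_homs t G| = #|collapse_homs t H|.
Proof.
move=> CF eGH; have [F' [p [cp _ e]]] := contraction_along_edge t.
rewrite -!(eq_collapse_homs _ e) -!(hom_contraction _ cp); apply: eGH.
by apply: contr_closed CF _; exists p.
Qed.

(* The maps with a given set L of collapsed edges are the homomorphisms from the
   contraction of F along L. *)
Lemma card_homs_loop F G H : C F -> hom_equiv C G H ->
  #|homs (@adj F) (loop_rel true (@adj G))| =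
  #|homs (@adj F) (loop_rel true (@adj H))|.
Proof.
move=> CF eGH.
pose E := [set p : 'I_(nv F) * 'I_(nv F) | adj p.1 p.2].
pose phi (T : finType) (f : {ffun 'I_(nv F) -> T}) := [set p in E | f p.1 == f p.2].
have phiE K K' (f0 : {ffun 'I_(nv F) -> 'I_(nv K')}) :
    [set f in homs (@adj F) (loop_rel true (@adj K)) | phi _ f == phi _ f0] =
    collapse_homs f0 K.
  apply/setP => f; rewrite [LHS]inE.
  apply/andP/collapse_homsP => [[/homsP h /eqP/setP ephi] x y xy|h].
    have := ephi (x, y); rewrite !inE xy /= => <-; case: ifPn => // nfxy.
    by have := h _ _ xy; rewrite /loop_rel eqb_id (negbTE nfxy).
  split; first apply/homsP => x y xy.
    by have := h _ _ xy; rewrite /loop_rel eqb_id; case: ifP => _ ->; rewrite ?orbT.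
  apply/eqP/setP => -[x y]; rewrite !inE /=; case: (boolP (adj x y)) => //= xy.
  by have := h _ _ xy; case: ifP => // _; case: eqP => // ->; rewrite adj_irr.
rewrite (card_fibers _ (@phi _)) [RHS](card_fibers _ (@phi _)).
apply: eq_bigr => L _.
(* Any element [f0] of the fibre, on the [G] side or on the [H] side, describes both fibres over
   [L]; without such an element both are empty. *)
have eqL K (f0 : {ffun 'I_(nv F) -> 'I_(nv K)}) : phi _ f0 = L ->
    #|[set f in homs (@adj F) (loop_rel true (@adj G)) | phi _ f == L]| =
    #|[set f in homs (@adj F) (loop_rel true (@adj H)) | phi _ f == L]|.
  by move<-; rewrite !phiE (card_collapse_homs _ CF eGH).
set AG := [set f in _ | _]; set AH := [set f in _ | _].
have [AG0|[f0]] := set_0Vmem AG; last first.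
  by rewrite inE => /andP[_ /eqP]; apply: eqL.
have [AH0|[f0]] := set_0Vmem AH; last first.
  by rewrite inE => /andP[_ /eqP]; apply: eqL.
by rewrite AG0 AH0 !cards0.
Qed.
End LoopInvariance.

Lemma hom_complK F G : hom F (compl (compl G)) = hom F G.
Proof.
congr #|pred_of_set _|; apply: eq_homs => // x y /=.
rewrite /compl_adj /= /compl_adj; case: eqP => [->|_] /=; last by rewrite negbK.
by rewrite adj_irr.
Qed.

Lemma contraction_refl F : contraction F F.
Proof.
exists id; split; [|split] => [a|u v ->|a b]; [by exists a | exact: connect0 |].
apply/idP/andP => [ab|[_ /existsP[u /existsP[v /and3P[/eqP-> /eqP->]]]] //].
split; first by apply: contraTneq ab => ->; rewrite adj_irr.
by apply/existsP; exists a; apply/existsP; exists b; rewrite !eqxx.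
Qed.

(** Adjacency in the complement negates adjacency with loops, so [card_homs_negb] reduces the claim
    to looped counts for spanning subgraphs of [F], which are minors of [F]. *)
Lemma minor_closed_hom_equiv_compl C G H : minor_closed C ->
  hom_equiv C G H -> hom_equiv C (compl G) (compl H).
Proof.
move=> mC eGH F CF; rewrite !hom_compl.
have negE K : homs (@adj F) (loop_rel false (@adj K)) =
    homs (@adj F) (fun x y => ~~ loop_rel true (@adj K) x y).
  by apply: eq_homs => // x y; rewrite -loop_rel_negb.
rewrite !negE; apply: card_homs_negb => [|||s' ss' sub].
- exact: adj_sym.
- by apply: loop_rel_sym; exact: adj_sym.
- by apply: loop_rel_sym; exact: adj_sym.
have irr x : s' x x = false by apply/negbTE/negP => /sub; rewrite adj_irr.
apply: (@card_homs_loop C _ (SGraph ss' irr)) => // [F1 F2 CF1 ctr|].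
  by apply: mC CF1 _; exists F2; split=> //; exists id; split.
apply: mC CF _; exists F; split; first exact: contraction_refl.
by exists id; split=> // x y /sub.
Qed.

(** * Onto maps, injective homomorphisms, and fibres over a factor *)

Definition onto (A V : finType) (t : {ffun A -> V}) :=
  [forall v, [exists x, t x == v]].

Lemma onto_card_image (A V : finType) (t : {ffun A -> V}) :
  onto t -> #|image t A| = #|V|.
Proof.
move=> /forallP ot; apply: eq_card => v.
by have /existsP[x /eqP <-] := ot v; rewrite image_f.
Qed.

Lemma onto_inj (A V : finType) (t : {ffun A -> V}) :
  onto t -> #|A| <= #|V| -> injective t.
Proof.
move=> /onto_card_image ot le; suff : {in A &, injective t} by move=> h x y; apply: h.
by apply/image_injP; rewrite eqn_leq leq_image_card ot.
Qed.

Definition edges (A : finType) (s : rel A) := [set p : A * A | s p.1 p.2].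

Section InjectiveHom.
Variables (A B : finType) (s : rel A) (s' : rel B) (h : A -> B).
Hypotheses (h_inj : injective h) (h_hom : forall x y, s x y -> s' (h x) (h y)).

Let h2 (p : A * A) := (h p.1, h p.2).

Let h2_inj : injective h2.
Proof. by move=> [x y] [x' y'] [/h_inj-> /h_inj->]. Qed.

Let h2_sub : h2 @: edges s \subset edges s'.
Proof. by apply/subsetP => _ /imsetP[[x y] + ->]; rewrite !inE; apply: h_hom. Qed.

(** The edges of [s] inject into those of [s']; by cardinality they fill them, so [h] also reflects
    adjacency. *)
Lemma inj_hom_edges_eq : #|edges s'| <= #|edges s| ->
  forall x y, s' (h x) (h y) = s x y.
Proof.
move=> le x y.
have eE : h2 @: edges s = edges s'.
  by apply/eqP; rewrite eqEcard h2_sub card_imset.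
have := mem_imset (edges s) (x, y) h2_inj.
by rewrite eE !inE.
Qed.

End InjectiveHom.

Section SurjectiveCount.
Variables (b : bool) (A V : finType) (s : rel A).

(** The set on the left consists of the vertices of [w] missed by [f]; it contains the complement of
    [S] exactly when all second components lie in [S]. *)
Lemma card_homs_restrict (T : finType) (r : rel T) (w : rel V) (S : {set V}) :
  #|[set f in homs s (loop_rel b (prod_rel r w)) |
      ~: S \subset [set v | [forall x, (f x).2 != v]]]| =
  #|homs s (loop_rel b (prod_rel r (fun u v : {v | v \in S} => w (val u) (val v))))|.
Proof.
pose ext (g : {ffun A -> T * {v | v \in S}}) : {ffun A -> T * V} :=
  [ffun x => ((g x).1, val (g x).2)].
have inj : injective ext.
  move=> g g' /ffunP e; apply/ffunP => x; have := e x; rewrite !ffunE.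
  by case: (g x) (g' x) => [a u] [a' u'] /= [-> /val_inj ->].
have relE (p q : T * {v | v \in S}) :
    loop_rel b (prod_rel r w) (p.1, val p.2) (q.1, val q.2) =
    loop_rel b (prod_rel r (fun u v : {v | v \in S} => w (val u) (val v))) p q.
  by case: p q => [a u] [a' u']; rewrite /loop_rel /prod_rel /= !xpair_eqE val_eqE.
rewrite -[RHS](card_imset _ inj); apply: eq_card => f; rewrite [LHS]inE.
apply/andP/imsetP => [[/homsP hf /subsetP fS]|[g /homsP hg ->]]; last first.
  split; first by apply/homsP => x y /hg; rewrite !ffunE relE.
  apply/subsetP => v; rewrite !inE => vS; apply/forallP => x; rewrite ffunE.
  by apply: contraNneq vS => <-; apply: valP.
have inS x : (f x).2 \in S.
  apply/negPn/negP => fxS; have := fS (f x).2; rewrite !inE => /(_ fxS)/forallP/(_ x).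
  by rewrite eqxx.
have fE : f = ext [ffun x => ((f x).1, Sub (f x).2 (inS x))].
  by apply/ffunP => x; rewrite !ffunE /=; case: (f x).
exists [ffun x => ((f x).1, Sub (f x).2 (inS x))] => //.
apply/homsP => x y /hf; rewrite -relE !ffunE /=.
by case: (f x) (f y) => [? ?] [? ?].
Qed.

End SurjectiveCount.

Lemma edges_leq F : #|edges (@adj F)| <= nv F * nv F.
Proof. by rewrite -[nv F in leqRHS]card_ord -card_prod max_card. Qed.

Lemma contraction_nv F F' (p : 'I_(nv F) -> 'I_(nv F')) :
  contraction_map p -> nv F' <= nv F.
Proof.
case=> p_onto _; rewrite -(card_ord (nv F')) -[leqRHS]card_ord.
apply: leq_trans (leq_image_card p 'I_(nv F)); apply/subset_leq_card/subsetP => a _.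
by have [u <-] := p_onto a; rewrite image_f.
Qed.

(** On an edge collapsed by [t], looplessness of [F'] forces equal pairs, so [g] collapses it too;
    on any other edge the pairs have distinct second components and must be adjacent. *)
Lemma collapse_homs_prod F F' (t : {ffun 'I_(nv F) -> 'I_(nv F')}) K :
  t \in homs (@adj F) (loop_rel true (@adj F')) ->
  [set g | ffun_pair (g, t) \in
     homs (@adj F) (loop_rel true (prod_rel (@adj K) (@adj F')))] =
  collapse_homs t K.
Proof.
move=> /homsP ht; apply/setP => g; rewrite [LHS]inE.
have E x y : adj x y -> loop_rel true (prod_rel (@adj K) (@adj F'))
    (ffun_pair (g, t) x) (ffun_pair (g, t) y) =
    if t x == t y then g x == g y else adj (g x) (g y).
  move=> /ht; rewrite /loop_rel /prod_rel !eqb_id !ffunE /= xpair_eqE.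
  by case: eqP => [->|_] /=; rewrite ?adj_irr ?andbF ?orbF ?andbT // => ->; rewrite andbT.
by apply/homsP/collapse_homsP => h x y xy; [rewrite -E|rewrite E] => //; apply: h.
Qed.

Lemma hom_nv0 F G H : nv G = 0 -> nv H = 0 -> hom F G = hom F H.
Proof.
case: G H => [n a sa ia] [n' a' sa' ia'] /= e e'; subst n n'.
by congr #|pred_of_set _|; apply: eq_homs => // -[].
Qed.

(** The values outside the image of [i] are free. The product is kept in this raw form because only
    its independence of [g] and its positivity matter. *)
Lemma card_ffun_extend (A B T : finType) (i : A -> B) (g : {ffun A -> T}) :
  injective i ->
  #|[set f : {ffun B -> T} | [forall a, f (i a) == g a]]| =
  foldr muln 1 [seq if x \in codom i then 1 else #|T| | x : B].
Proof.
move=> i_inj.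
pose P (x : B) : pred T := if [pick a | i a == x] is Some a then pred1 (g a) else predT.
rewrite (eq_card (B := family P)) ?card_family => [|f].
  congr (foldr _ _ _); apply: eq_map => x; rewrite /P.
  case: pickP => [a /eqP <-|nx]; first by rewrite card1 codom_f.
  by case: codomP => // -[a ax]; have := nx a; rewrite ax eqxx.
rewrite inE; apply/forallP/familyP => [h x|h a]; rewrite ?/P.
  by case: pickP => [a /eqP <-|//]; rewrite inE.
have := h (i a); rewrite /P; case: pickP => [a' /eqP/i_inj ->|/(_ a)]; last by rewrite eqxx.
by rewrite inE.
Qed.

(** * Classes whose equivalence is preserved under complements *)

Section Complement.
Variable C : gclass.

Lemma hom_equiv_prod G H (V : finType) (w : rel V) (ws : symmetric w) :
  hom_equiv C G H ->
  hom_equiv C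
    (rel_graph (prod_rel_sym (@adj_sym G) ws) (prod_rel_irr w (@adj_irr G)))
    (rel_graph (prod_rel_sym (@adj_sym H) ws) (prod_rel_irr w (@adj_irr H))).
Proof. by move=> eGH F CF; rewrite !hom_rel_graph !card_homs_prod [#|_|]eGH. Qed.

(** The flag lets one inversion argument serve both complements and graphs with loops. *)
Definition loop_invariant b F := forall G H, hom_equiv C G H ->
  #|homs (@adj F) (loop_rel b (@adj G))| = #|homs (@adj F) (loop_rel b (@adj H))|.

(* Moebius inversion over the image of the second component: maps avoiding a set of
   vertices of w are counted by the product with the rest of w. *)
Lemma loop_invariant_onto b F G H (V : finType) (w : rel V) :
  symmetric w -> loop_invariant b F -> hom_equiv C G H ->
  \sum_(t : {ffun 'I_(nv F) -> V} | onto t)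
    #|[set g | ffun_pair (g, t) \in homs (@adj F) (loop_rel b (prod_rel (@adj G) w))]| =
  \sum_(t : {ffun 'I_(nv F) -> V} | onto t)
    #|[set g | ffun_pair (g, t) \in homs (@adj F) (loop_rel b (prod_rel (@adj H) w))]|.
Proof.
move=> ws inv eGH.
(* The vertices of [w] missed by [f], so that onto means an empty value. *)
pose phi (T : finType) (f : {ffun 'I_(nv F) -> T * V}) :=
  [set v | [forall x, (f x).2 != v]].
have ontoE K : \sum_(t : {ffun 'I_(nv F) -> V} | onto t)
    #|[set g | ffun_pair (g, t) \in homs (@adj F) (loop_rel b (prod_rel (@adj K) w))]| =
    #|[set f in homs (@adj F) (loop_rel b (prod_rel (@adj K) w)) | phi _ f == set0]|.
  rewrite card_ffun_pair big_mkcond; apply: eq_bigr => t _.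
  have phi0 g : (phi 'I_(nv K) (ffun_pair (g, t)) == set0) = onto t.
    apply/eqP/forallP => [/setP h v|h].
      have := h v; rewrite !inE => /negbT; rewrite negb_forall => /existsP[x].
      by rewrite negbK ffunE /= => xv; apply/existsP; exists x.
    apply/setP => v; rewrite !inE; apply/negbTE; rewrite negb_forall.
    by have /existsP[x xv] := h v; apply/existsP; exists x; rewrite negbK ffunE.
  case: ifPn => ot; first by apply: eq_card => g; rewrite !inE phi0 ot andbT.
  symmetry; apply/eqP; rewrite cards_eq0; apply/eqP/setP => g.
  by rewrite !inE phi0 (negbTE ot) andbF.
rewrite !ontoE; apply: card_fiber_moebius => S.
rewrite -[S]setCK !card_homs_restrict.
have ws' : symmetric (fun u v : {v | v \in ~: S} => w (val u) (val v)).
  by move=> u v; apply: ws.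
have := inv _ _ (hom_equiv_prod ws' eGH).
by rewrite !card_homs_loop_rel_graph.
Qed.

Hypothesis C_closed : hd_closed C.
Hypothesis C_compl : forall G H, hom_equiv C G H -> hom_equiv C (compl G) (compl H).

Lemma loop_invariant_compl F : C F -> loop_invariant false F.
Proof. by move=> CF G H /C_compl eGH; rewrite -!hom_compl; apply: eGH. Qed.

(* Take w = s: an onto t permutes the vertices, and the maps above t are those sending no
   edge of F lying in t^-1(s) to an edge. Either there are fewer such edges than in s, or
   t^-1(s) is a copy of s inside F. *)
Lemma card_homs_neg_spanning F (s : rel 'I_(nv F)) G H :
  C F -> symmetric s -> subrel s (@adj F) -> hom_equiv C G H ->
  #|homs s (fun x y => ~~ @adj G x y)| = #|homs s (fun x y => ~~ @adj H x y)|.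
Proof.
move=> CF ss sub eGH.
have [n] := ubnP #|edges s|; elim: n s ss sub => // n IHn s ss sub ltn.
pose st (t : {ffun 'I_(nv F) -> 'I_(nv F)}) x y := adj x y && s (t x) (t y).
have inj_onto (t : {ffun 'I_(nv F) -> 'I_(nv F)}) : onto t -> injective t.
  by move=> ot; exact: (onto_inj ot (leqnn _)).
have stE K t : onto t ->
    [set g | ffun_pair (g, t) \in
       homs (@adj F) (loop_rel false (prod_rel (@adj K) s))] =
    homs (st t) (fun x y => ~~ @adj K x y).
  move=> /inj_onto tinj; apply/setP => g; rewrite [LHS]inE.
  apply/homsP/homsP => h x y.
    case/andP => /h; rewrite /loop_rel eqbF_neg /prod_rel !ffunE /= negb_or.
    by case/andP => _ nadj sxy; move: nadj; rewrite sxy andbT.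
  move=> xy; have := h x y; rewrite /st xy /loop_rel /prod_rel !ffunE /=.
  rewrite eqbF_neg negb_or xpair_eqE (inj_eq tinj).
  have -> : (x == y) = false by apply: contraTF xy => /eqP->; rewrite adj_irr.
  by rewrite andbF /=; case: (s _ _) => [/(_ isT)|_]; rewrite ?andbT ?andbF.
have := loop_invariant_onto ss (loop_invariant_compl CF) eGH.
rewrite (eq_bigr (fun t => #|homs (st t) (fun x y => ~~ @adj G x y)|)); last first.
  by move=> t ot; rewrite stE.
rewrite [RHS](eq_bigr (fun t => #|homs (st t) (fun x y => ~~ @adj H x y)|)); last first.
  by move=> t ot; rewrite stE.
move=> eqsum; pose id' := [ffun x : 'I_(nv F) => x].
have st_id : st id' =2 s.
  by move=> x y; rewrite /st !ffunE andbC; apply/andb_idr/sub.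
(* The identity contributes the wanted count, since [s] lies inside the edges of [F]. *)
apply: (sum_eq_cancel (t0 := id') eqsum).
- move=> t ot; have tinj := inj_onto t ot.
  have [lt|ge] := ltnP #|edges (st t)| #|edges s|; [left|right].
    apply: IHn; last by apply: leq_trans lt _.
      by move=> x y; rewrite /st adj_sym ss.
    by move=> x y /andP[].
  have tbij : bijective t by apply: injF_bij.
  have sE x y : s (t x) (t y) = st t x y.
    by apply: inj_hom_edges_eq => // u v /andP[].
  by split; apply: (@card_homs_iso _ _ _ _ _ _ _ _ t id) => //; exists id.
- by apply/forallP => v; apply/existsP; exists v; rewrite ffunE.
- by rewrite (eq_homs st_id (fun _ _ => erefl)).
- by rewrite (eq_homs st_id (fun _ _ => erefl)).
Qed.

(** Adjacency is its own double negation, so a second inversion turns the counts of edge-avoiding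
    maps back into homomorphism counts. *)
Lemma spanning_closed F (s : rel 'I_(nv F)) (ss : symmetric s) (si : irreflexive s) :
  C F -> subrel s (@adj F) -> C (SGraph ss si).
Proof.
move=> CF sub; apply: (proj1 (C_closed _)) => G H eGH.
have negE K : homs s (@adj K) = homs s (fun x y => ~~ ~~ @adj K x y).
  by apply: eq_homs => // x y; rewrite negbK.
rewrite /hom -/(homs s (@adj G)) -/(homs s (@adj H)) !negE.
apply: card_homs_negb => // [x y|x y|s' ss' sub']; try by rewrite adj_sym.
by apply: (@card_homs_neg_spanning F s' G H) => // x y /sub'/sub.
Qed.

(** The looped relation negates the complement relation, and the spanning subgraphs arising in the
    inversion are now in [C]. *)
Lemma loop_invariant_loop F : C F -> loop_invariant true F.
Proof.
move=> CF G H eGH.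
have negE K : homs (@adj F) (loop_rel true (@adj K)) =
    homs (@adj F) (fun x y => ~~ loop_rel false (@adj K) x y).
  by apply: eq_homs => // x y; rewrite -loop_rel_negb.
rewrite !negE; apply: card_homs_negb => [|||s' ss' sub].
- exact: adj_sym.
- by apply: loop_rel_sym; exact: adj_sym.
- by apply: loop_rel_sym; exact: adj_sym.
have irr x : s' x x = false by apply/negbTE/negP => /sub; rewrite adj_irr.
exact: (@loop_invariant_compl (SGraph ss' irr) (spanning_closed _ _ CF sub)).
Qed.

(* Take w = F': the maps above an onto t : F -> F' with loops are the homomorphisms from a
   contraction F2 of F that maps onto F'. So F2 has more vertices than F', or as many
   vertices and fewer edges, or is isomorphic to F'. *)
Lemma contraction_closed F F' : C F -> contraction F F' -> C F'.
Proof.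
move=> CF [p0 /= cp0].
(* A lexicographic measure: the factor exceeds any edge count of a contraction of [F], so one more
   vertex outweighs all edges. *)
pose m K := (nv F - nv K) * (nv F * nv F).+1 + #|edges (@adj K)|.
have [n] := ubnP (m F'); elim: n F' p0 cp0 => // n IHn F' p cp ltn.
apply: (proj1 (C_closed _)) => G H eGH.
pose t0 := [ffun x => p x].
have t0_onto : onto t0.
  case: cp => p_onto _; apply/forallP => a; apply/existsP.
  by have [u <-] := p_onto a; exists u; rewrite ffunE.
have t0_hom : t0 \in homs (@adj F) (loop_rel true (@adj F')).
  case: cp => [_ [_ p_adj]]; apply/homsP => x y xy.
  rewrite /loop_rel eqb_id !ffunE; case: eqP => //= /eqP npxy.
  rewrite p_adj npxy; apply/existsP; exists x; apply/existsP; exists y.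
  by rewrite !eqxx.
have t0E K : #|[set g | ffun_pair (g, t0) \in
     homs (@adj F) (loop_rel true (prod_rel (@adj K) (@adj F')))]| = hom F' K.
  rewrite collapse_homs_prod // (hom_contraction _ cp); congr #|pred_of_set _|.
  by apply: eq_collapse_homs => x y _; rewrite !ffunE.
have := loop_invariant_onto (@adj_sym F') (loop_invariant_loop CF) eGH.
move/sum_eq_cancel; apply; [|exact: t0_onto|exact: t0E|exact: t0E].
move=> t ot.
have [t_hom|nt_hom] := boolP (t \in homs (@adj F) (loop_rel true (@adj F'))); last first.
  left; have emp K : [set g | ffun_pair (g, t) \in
      homs (@adj F) (loop_rel true (prod_rel (@adj K) (@adj F')))] = set0.
    apply/setP => g; rewrite [RHS]inE [LHS]inE; apply/negbTE.
    apply: contra nt_hom => /homsP h; apply/homsP => x y /h.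
    rewrite /loop_rel /prod_rel !eqb_id !ffunE /= xpair_eqE.
    by case/orP => /andP[_ ->]; rewrite ?orbT.
  by rewrite !emp !cards0.
have [F2 [q [cq qt qtE]]] := contraction_along_edge t.
rewrite !collapse_homs_prod // -!(eq_collapse_homs _ qtE) -!(hom_contraction _ cq).
have [q_onto [_ q_adj]] := cq.
have ex a : exists u, q u == a by have [u <-] := q_onto a; exists u.
have repK a : q (xchoose (ex a)) = a by apply/eqP/(xchooseP (ex a)).
(* The factorization of [t] through [q]. It is a loop-free homomorphism to [F'] because [q]
   collapses every edge that [t] does. *)
pose h := [ffun a => t (xchoose (ex a))].
have hq x : h (q x) = t x by rewrite ffunE; apply: qt; rewrite repK.
have h_onto : onto h.
  apply/forallP => a; have /existsP[x /eqP <-] := forallP ot a.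
  by apply/existsP; exists (q x); rewrite hq.
have h_hom x y : adj x y -> adj (h x) (h y).
  rewrite q_adj => /andP[nxy /existsP[u /existsP[v /and3P[/eqP qu /eqP qv uv]]]].
  rewrite -qu -qv !hq; have := homsP _ _ _ t_hom _ _ uv.
  by rewrite /loop_rel eqb_id -qtE // qu qv (negbTE nxy).
have le2 : nv F' <= nv F2.
  by have := leq_image_card h 'I_(nv F2); rewrite onto_card_image // !card_ord.
have leF2 := contraction_nv cq.
have IH : m F2 < m F' -> hom F2 G = hom F2 H.
  by move=> lt; apply: eGH; apply: (IHn F2 q cq); apply: leq_trans lt _.
have [lt|ge] := ltnP (nv F') (nv F2).
  left; apply: IH; rewrite /m.
  have -> : nv F - nv F' = (nv F - nv F2) + (nv F2 - nv F') by lia.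
  rewrite mulnDl -addnA ltn_add2l; apply: leq_trans (leq_addr _ _).
  have e := edges_leq F2; apply: leq_trans (leq_pmull _ _); last by rewrite subn_gt0.
  by rewrite ltnS; apply: leq_trans e _; apply: leq_mul.
have eqnv : nv F2 = nv F' by apply/eqP; rewrite eqn_leq ge.
have h_inj : injective h by apply: onto_inj h_onto _; rewrite !card_ord.
have [lte|gee] := ltnP #|edges (@adj F2)| #|edges (@adj F')|.
  by left; apply: IH; rewrite /m [nv F - nv F2](congr1 (subn _) eqnv) ltn_add2l.
(* Here [h] is an isomorphism from [F2] to [F']. *)
right; have hE := inj_hom_edges_eq h_inj h_hom gee.
have h_bij : bijective h by apply: inj_card_bij => //; rewrite !card_ord eqnv.
by split; apply: (@card_homs_iso _ _ _ _ _ _ _ _ h id) => //; exists id.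
Qed.

(** The image of [M], padded with the remaining vertices of [F] as isolated ones, is a spanning
    subgraph and lies in [C]. Each isolated vertex contributes a factor [nv K], which can be
    cancelled once [nv G = nv H] is known. *)
Lemma subgraph_closed F M : C F -> subgraph M F -> C M.
Proof.
move=> CF [i [i_inj i_hom]]; apply: (proj1 (C_closed _)) => G H eGH.
pose s x y := [exists a, exists b, [&& i a == x, i b == y & adj a b]].
have sE a b : s (i a) (i b) = adj a b.
  apply/existsP/idP => [[a' /existsP[b' /and3P[]]]|ab].
    by move=> /eqP/i_inj-> /eqP/i_inj->.
  by exists a; apply/existsP; exists b; rewrite !eqxx.
have ss : symmetric s.
  by move=> x y; apply/existsP/existsP => -[a /existsP[b /and3P[xa yb ab]]];
    exists b; apply/existsP; exists a; rewrite xa yb adj_sym.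
have sub : subrel s (@adj F).
  by move=> x y /existsP[a /existsP[b /and3P[/eqP <- /eqP <-]]]; apply: i_hom.
have si : irreflexive s by move=> x; apply/negbTE/negP => /sub; rewrite adj_irr.
have homE K : hom (SGraph ss si) K = hom M K *
    foldr muln 1 [seq if x \in codom i then 1 else nv K | x : 'I_(nv F)].
  rewrite /hom -/(homs s (@adj K)) -/(homs (@adj M) (@adj K)).
  pose res (f : {ffun 'I_(nv F) -> 'I_(nv K)}) := [ffun a => f (i a)].
  rewrite (card_fibers _ res) (bigID (mem (homs (@adj M) (@adj K)))) /=.
  rewrite [X in _ + X = _]big1 => [|g ng]; last first.
    apply/eqP; rewrite cards_eq0; apply/eqP/setP => f; rewrite [RHS]inE [LHS]inE.
    apply/negbTE; apply: contra ng => /andP[/homsP hf /eqP <-].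
    by apply/homsP => a b ab; rewrite !ffunE; apply: hf; rewrite sE.
  rewrite addn0 -sum_nat_const; apply: eq_bigr => g /homsP hg.
  rewrite -[nv K in RHS]card_ord -(card_ffun_extend g i_inj).
  apply: eq_card => f; rewrite [LHS]inE [RHS]inE.
  apply/andP/forallP => [[_ /eqP <-] a|h]; first by rewrite ffunE.
  split; last by apply/eqP/ffunP => a; rewrite ffunE; apply/eqP.
  apply/homsP => x y /existsP[a /existsP[b /and3P[/eqP <- /eqP <-]]].
  by rewrite (eqP (h a)) (eqP (h b)); apply: hg.
have eqK := eGH _ (spanning_closed ss si CF sub).
(* With no vertices in [F] the extra factor is an empty product, and the edgeless graph could not
   determine [nv G]. *)
have [nvF0|nvF_gt0] := posnP (nv F).
  move: eqK; rewrite !homE.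
  have e : [seq if x \in codom i then 1 else nv G | x : 'I_(nv F)] = [::].
    by apply: size0nil; rewrite size_map -cardE card_ord.
  have e' : [seq if x \in codom i then 1 else nv H | x : 'I_(nv F)] = [::].
    by apply: size0nil; rewrite size_map -cardE card_ord.
  by rewrite e e' !muln1.
have eqnv : nv G = nv H.
  (* The edgeless spanning subgraph of [F] has [nv K ^ nv F] homomorphisms to [K]. *)
  pose z (x y : 'I_(nv F)) := false.
  have zs : symmetric z by [].
  have zi : irreflexive z by [].
  have zsub : subrel z (@adj F) by [].
  have := eGH _ (spanning_closed zs zi CF zsub).
  have zE K : hom (SGraph zs zi) K = nv K ^ nv F.
    have <- : #|{ffun 'I_(nv F) -> 'I_(nv K)}| = nv K ^ nv F by rewrite card_ffun !card_ord.
    by apply: eq_card => f; apply/homsP.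
  by rewrite !zE => /eqP; rewrite eqn_exp2r // => /eqP.
have [nvG0|nvG_gt0] := posnP (nv G); first by apply: hom_nv0; rewrite -?eqnv.
move: eqK; rewrite !homE -eqnv => /eqP; rewrite eqn_pmul2r => [/eqP //|].
by rewrite /image_mem; elim: (enum_mem _) => //= x l IHl; rewrite muln_gt0 IHl andbT; case: ifP.
Qed.

End Complement.

Theorem theorem2 (C : gclass) :
  hd_closed C ->
  (minor_closed C <->
   (forall G H : sgraph, hom_equiv C G H <-> hom_equiv C (compl G) (compl H))).
Proof.
move=> C_closed; split=> [mC G H|C_compl F M CF [F' [ctr sub]]].
  split=> [|eGH F CF]; first exact: minor_closed_hom_equiv_compl.
  (* Complementation is an involution, so the converse is the forward direction applied to the
     complements. *)
  rewrite -(hom_complK F G) -(hom_complK F H); move: F CF.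
  exact: minor_closed_hom_equiv_compl.
have C_compl' G H : hom_equiv C G H -> hom_equiv C (compl G) (compl H).
  by move/C_compl.
apply: subgraph_closed sub => //.
exact: contraction_closed ctr.
Qed.
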